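(* Let $G$ be a group. There exists a group $\mathrm{Pol}_2(G)$ and a natural bijection $\hom(\mathrm{Pol}_2(G),?)\to \mathrm{Quad}(G,?)$ of functors from groups to sets, i.e., the functor $\mathrm{Quad}(G,?)$ is representable. More specifically, there exists a universal unital quadratic map $\varphi\colon G\to \mathrm{Pol}_2(G)$ such that for every group $H$, every unital quadratic map $\varphi'\colon G\to H$ can be expressed as $\varphi'=\psi\circ\varphi$ for a unique homomorphism $\psi\colon \mathrm{Pol}_2(G)\to H$.
   Context: For groups $G,H$, a map $\varphi\colon G\to H$ and $k\in G$, the finite difference is $(\Delta_k\varphi)(g):=\varphi(kg)\varphi(g)^{-1}$. A map $\varphi\colon G\to H$ is polynomial of degree $-1$ if $\varphi(g)=1$ for all $g\in G$; for $d\ge -1$, $\varphi$ is polynomial of degree $d+1$ if $\Delta_k\varphi$ is polynomial of degree $d$ for every $k\in G$ (so ''degree $d$'' means ''degree at most $d$''). A quadratic map is a polynomial map of degree $2$. A map is unital if $\varphi(1)=1$. $\mathrm{Quad}(G,H)$ denotes the set of unital quadratic maps $G\to H$; for fixed $G$, $H\mapsto \mathrm{Quad}(G,H)$ is a functor from groups to sets via post-composition with homomorphisms. *)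

(* Defs.v *)
From HB Require Import structures.
From mathcomp Require Import all_boot.

Set Implicit Arguments.
Unset Strict Implicit.
Unset Printing Implicit Defensive.

Local Open Scope group_scope.

(* [groupType] is the type of arbitrary, possibly infinite, groups: the
   [choiceType] structure it puts on the carrier is no restriction classically,
   and [group_hom] does not depend on it. *)

Notation group_hom G H := (UMagmaMorphism.type G H).

Definition finite_difference (G H : groupType) (k : G) (phi : G -> H) : G -> H :=
  fun g => phi (k * g) * (phi g)^-1.

(* The degree is shifted by one so that the recursion, which starts at degree
   -1, runs over [nat]: [polynomial_lt n phi] says that [phi] is polynomial of
   degree at most [n - 1]. *)
Fixpoint polynomial_lt (G H : groupType) (n : nat) (phi : G -> H) : Prop :=
  if n is m.+1 then forall k : G, polynomial_lt m (finite_difference k phi)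
  else forall g : G, phi g = 1.

Definition quadratic (G H : groupType) (phi : G -> H) : Prop :=
  polynomial_lt 3 phi.

Definition unital (G H : groupType) (phi : G -> H) : Prop := phi 1 = 1.

Record Quad (G H : groupType) := MkQuad {
  quad_fun :> G -> H;
  quad_quadratic : quadratic quad_fun;
  quad_unital : unital quad_fun
}.

Lemma polynomial_lt_ext (G H : groupType) (n : nat) (phi phi' : G -> H) :
  phi =1 phi' -> polynomial_lt n phi -> polynomial_lt n phi'.
Proof.
elim: n phi phi' => [|n IHn] phi phi' eq_phi /= phiP.
  by move=> g; rewrite -eq_phi.
move=> k; apply: IHn (phiP k) => g.
by rewrite /finite_difference !eq_phi.
Qed.

Lemma polynomial_lt_comp (G H K : groupType) (f : group_hom H K)
    (n : nat) (phi : G -> H) :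
  polynomial_lt n phi -> polynomial_lt n (f \o phi).
Proof.
elim: n phi => [|n IHn] phi /= phiP.
  by move=> g; rewrite /= phiP gmulf1.
move=> k; apply: polynomial_lt_ext (IHn _ (phiP k)) => g.
by rewrite /finite_difference /= gmulfM gmulfV.
Qed.

Lemma unital_comp (G H K : groupType) (f : group_hom H K)
    (phi : G -> H) : unital phi -> unital (f \o phi).
Proof. by rewrite /unital /= => ->; rewrite gmulf1. Qed.

(* The action of the functor [Quad G] on the homomorphism [f]. *)
Definition Quad_map (G H K : groupType) (f : group_hom H K)
    (phi : Quad G H) : Quad G K :=
  MkQuad (polynomial_lt_comp f (quad_quadratic phi) : quadratic (f \o phi))
         (unital_comp f (quad_unital phi)).

(* Main.v *)
Require Import Defs.
From HB Require Import structures.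
From mathcomp Require Import all_boot.
From mathcomp Require Import boolp.

(* [Pol2 G] is the group of words in the elements of [G] and their formal
   inverses, where two words are identified when every unital quadratic map
   from [G] to a group gives them the same value.  Evaluation at a quadratic
   map then factors through the quotient by construction.  The evaluation
   homomorphisms separate points, so a map to the quotient is quadratic as soon
   as its composites with all of them are; this applies to the inclusion of
   generators, whose composites are the unital quadratic maps themselves. *)

Set Implicit Arguments.
Unset Strict Implicit.
Unset Printing Implicit Defensive.

Local Open Scope group_scope.
Local Open Scope quotient_scope.

Lemma Quad_ext (G H : groupType) (phi phi' : Quad G H) :
  phi =1 phi' -> phi = phi'.
Proof.
case: phi phi' => [f fq fu] [f' f'q f'u] /= /funext eq_ff'.
by case: _ / eq_ff' in f'q f'u *; congr MkQuad; apply: Prop_irrelevance.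
Qed.

Lemma group_hom_ext (G H : groupType) (psi psi' : group_hom G H) :
  psi =1 psi' -> psi = psi'.
Proof.
case: psi psi' => [f [[f1] [fM]]] [f' [[f'1] [f'M]]] /= /funext eq_ff'.
case: _ / eq_ff' in f'1 f'M *.
by rewrite (Prop_irrelevance f'1 f1) (Prop_irrelevance f'M fM).
Qed.

(** Homomorphisms commute with finite differences, so induction on [n] brings everything down to the
    constant map 1, where joint triviality of the kernels concludes. *)
Lemma polynomial_lt_separated (G K : groupType) (I : Type)
    (L : I -> groupType) (f : forall i, group_hom K (L i))
    (n : nat) (phi : G -> K) :
  (forall x, (forall i, f i x = 1) -> x = 1) ->
  (forall i, polynomial_lt n (f i \o phi)) -> polynomial_lt n phi.
Proof.
move=> fsep; elim: n phi => [|n IHn] phi /= phiP.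
  by move=> g; apply: fsep => i; apply: phiP.
move=> k; apply: IHn => i; apply: polynomial_lt_ext (phiP i k) => g /=.
by rewrite /finite_difference /= gmulfM gmulfV.
Qed.

Section Pol2.

Variable G : groupType.

(* The letter [(b, g)] stands for [g^-1] if [b] and for [g] otherwise. *)
Definition letter_value (H : groupType) (phi : G -> H) (l : bool * G) : H :=
  if l.1 then (phi l.2)^-1 else phi l.2.

Definition word_value (H : groupType) (phi : G -> H) (w : seq (bool * G)) : H :=
  \big[*%g/1]_(l <- w) letter_value phi l.

Definition word_inv (w : seq (bool * G)) : seq (bool * G) :=
  rev [seq (~~ l.1, l.2) | l <- w].

Lemma word_value_cat (H : groupType) (phi : G -> H) (v w : seq (bool * G)) :
  word_value phi (v ++ w) = word_value phi v * word_value phi w.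
Proof. exact: big_cat. Qed.

Lemma word_value_nil (H : groupType) (phi : G -> H) : word_value phi [::] = 1.
Proof. exact: big_nil. Qed.

Lemma word_value_seq1 (H : groupType) (phi : G -> H) (l : bool * G) :
  word_value phi [:: l] = letter_value phi l.
Proof. exact: big_seq1. Qed.

Lemma word_value_inv (H : groupType) (phi : G -> H) (w : seq (bool * G)) :
  word_value phi (word_inv w) = (word_value phi w)^-1.
Proof.
elim: w => [|[b g] w IHw]; first by rewrite word_value_nil invg1.
rewrite /word_inv /= rev_cons -cats1 -(cat1s (b, g)) !word_value_cat IHw.
rewrite !word_value_seq1 invgM /letter_value /=.
by case: b; rewrite //= invgK.
Qed.

(** As [Prop] is impredicative, ranging over all groups [H] does not raise the universe level of the
    quotient. *)
Definition word_eqv (v w : seq (bool * G)) : bool :=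
  `[< forall (H : groupType) (phi : Quad G H),
        word_value phi v = word_value phi w >].

Lemma word_eqv_refl : reflexive word_eqv.
Proof. by move=> w; apply/asboolP. Qed.

Lemma word_eqv_sym : symmetric word_eqv.
Proof. by move=> v w; apply/asboolP/asboolP => vw H phi; rewrite vw. Qed.

Lemma word_eqv_trans : transitive word_eqv.
Proof.
move=> v u w /asboolP uv /asboolP vw.
by apply/asboolP => H phi; rewrite uv vw.
Qed.

Canonical word_equiv :=
  EquivRel word_eqv word_eqv_refl word_eqv_sym word_eqv_trans.

Definition Pol2 : Type := {eq_quot word_eqv}.

HB.instance Definition _ := Choice.on Pol2.

Definition Pol2_pi (w : seq (bool * G)) : Pol2 := \pi_{eq_quot word_eqv} w.

(** Reading off the chosen representative makes sense for any [phi]; independence of that choice is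
    [Pol2_eval_pi], for unital quadratic [phi]. *)
Definition Pol2_eval (H : groupType) (phi : G -> H) (x : Pol2) : H :=
  word_value phi (repr (x : {eq_quot word_eqv})).

Lemma Pol2_eval_pi (H : groupType) (phi : Quad G H) (w : seq (bool * G)) :
  Pol2_eval phi (Pol2_pi w) = word_value phi w.
Proof.
have /eqmodP/asboolP : repr (Pol2_pi w) = w %[mod {eq_quot word_eqv}].
  exact: reprK.
exact.
Qed.

(** This is the definition of [word_eqv] on representatives. It reduces identities in [Pol2], the
    group axioms among them, to identities in each [H]. *)
Lemma Pol2_eval_inj (x y : Pol2) :
  (forall (H : groupType) (phi : Quad G H),
     Pol2_eval phi x = Pol2_eval phi y) -> x = y.
Proof.
move=> eq_xy; rewrite -[x]reprK -[y]reprK.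
by apply/eqmodP/asboolP; apply: eq_xy.
Qed.

Definition Pol2_mul (x y : Pol2) : Pol2 :=
  Pol2_pi (repr (x : {eq_quot word_eqv}) ++ repr (y : {eq_quot word_eqv})).

Definition Pol2_inv (x : Pol2) : Pol2 :=
  Pol2_pi (word_inv (repr (x : {eq_quot word_eqv}))).

Lemma Pol2_eval_mul (H : groupType) (phi : Quad G H) :
  {morph Pol2_eval phi : x y / Pol2_mul x y >-> x * y}.
Proof. by move=> x y; rewrite Pol2_eval_pi word_value_cat. Qed.

Lemma Pol2_eval_one (H : groupType) (phi : Quad G H) :
  Pol2_eval phi (Pol2_pi [::]) = 1.
Proof. by rewrite Pol2_eval_pi word_value_nil. Qed.

Lemma Pol2_eval_inv (H : groupType) (phi : Quad G H) :
  {morph Pol2_eval phi : x / Pol2_inv x >-> x^-1}.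
Proof. by move=> x; rewrite Pol2_eval_pi word_value_inv. Qed.

Lemma Pol2_mulA : associative Pol2_mul.
Proof.
by move=> x y z; apply: Pol2_eval_inj => H phi; rewrite !Pol2_eval_mul mulgA.
Qed.

Lemma Pol2_mul1x : left_id (Pol2_pi [::]) Pol2_mul.
Proof.
move=> x; apply: Pol2_eval_inj => H phi.
by rewrite Pol2_eval_mul Pol2_eval_one mul1g.
Qed.

Lemma Pol2_mulx1 : right_id (Pol2_pi [::]) Pol2_mul.
Proof.
move=> x; apply: Pol2_eval_inj => H phi.
by rewrite Pol2_eval_mul Pol2_eval_one mulg1.
Qed.

Lemma Pol2_mulVx : left_inverse (Pol2_pi [::]) Pol2_inv Pol2_mul.
Proof.
move=> x; apply: Pol2_eval_inj => H phi.
by rewrite Pol2_eval_mul Pol2_eval_inv Pol2_eval_one mulVg.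
Qed.

Lemma Pol2_mulxV : right_inverse (Pol2_pi [::]) Pol2_inv Pol2_mul.
Proof.
move=> x; apply: Pol2_eval_inj => H phi.
by rewrite Pol2_eval_mul Pol2_eval_inv Pol2_eval_one mulgV.
Qed.

HB.instance Definition _ :=
  isGroup.Build Pol2 Pol2_mulA Pol2_mul1x Pol2_mulx1 Pol2_mulVx Pol2_mulxV.

Section Eval.

Variables (H : groupType) (phi : Quad G H).

HB.instance Definition _ :=
  isUMagmaMorphism.Build Pol2 H (Pol2_eval phi)
    (Pol2_eval_one phi, Pol2_eval_mul phi).

Definition Pol2_lift : group_hom Pol2 H := Pol2_eval phi.

End Eval.

Definition Pol2_gen (g : G) : Pol2 := Pol2_pi [:: (false, g)].

Lemma Pol2_lift_gen (H : groupType) (phi : Quad G H) (g : G) :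
  Pol2_lift phi (Pol2_gen g) = phi g.
Proof. by rewrite /= Pol2_eval_pi word_value_seq1. Qed.

Lemma Pol2_gen_quadratic : quadratic Pol2_gen.
Proof.
(* Dependent pairs gather the evaluations at all unital quadratic maps, into all groups, in one
   separating family. *)
pose f (i : {H : groupType & Quad G H}) := Pol2_lift (projT2 i).
apply: (polynomial_lt_separated (f := f)) => [x fx1|[H phi]].
  apply: Pol2_eval_inj => H phi; rewrite Pol2_eval_one.
  exact: (fx1 (existT _ H phi)).
apply: polynomial_lt_ext (quad_quadratic phi) => g.
by rewrite /f /= -/(Pol2_lift phi) Pol2_lift_gen.
Qed.

Lemma Pol2_gen_unital : unital Pol2_gen.
Proof.
apply: Pol2_eval_inj => H phi.
by rewrite (Pol2_lift_gen phi) Pol2_eval_one quad_unital.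
Qed.

Definition Pol2_quad : Quad G Pol2 := MkQuad Pol2_gen_quadratic Pol2_gen_unital.

(** In particular the image of [Pol2_gen] generates [Pol2], which is the source of uniqueness. *)
Lemma Pol2_piE (w : seq (bool * G)) : Pol2_pi w = word_value Pol2_quad w.
Proof.
have pi_cons l v : Pol2_pi (l :: v) = Pol2_pi [:: l] * Pol2_pi v.
  apply: Pol2_eval_inj => H phi.
  by rewrite Pol2_eval_mul !Pol2_eval_pi -(cat1s l v) word_value_cat.
elim: w => [|l w IHw]; first by rewrite word_value_nil.
rewrite pi_cons IHw -(cat1s l w) word_value_cat word_value_seq1; congr (_ * _).
case: l => [[] g] //=; apply: Pol2_eval_inj => H phi.
by rewrite Pol2_eval_inv !Pol2_eval_pi !word_value_seq1.
Qed.

Lemma group_hom_word_value (H K : groupType) (f : group_hom H K) (phi : G -> H)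
    (w : seq (bool * G)) : f (word_value phi w) = word_value (f \o phi) w.
Proof.
elim: w => [|[b g] w IHw]; first by rewrite !word_value_nil gmulf1.
rewrite -cat1s !word_value_cat gmulfM IHw !word_value_seq1 /letter_value /=.
by case: b; rewrite //= gmulfV.
Qed.

(** By [Pol2_piE] each element is a word in the generators, and [psi] is multiplicative on words, so
    its values on generators determine it. *)
Lemma Pol2_lift_unique (H : groupType) (psi : group_hom Pol2 H) :
  Pol2_lift (Quad_map psi Pol2_quad) = psi.
Proof.
apply: group_hom_ext => x; rewrite -[x]reprK -/(Pol2_pi _).
rewrite [LHS]Pol2_eval_pi Pol2_piE.
by rewrite group_hom_word_value.
Qed.

Lemma Quad_map_Pol2_lift (H : groupType) (phi : Quad G H) :
  Quad_map (Pol2_lift phi) Pol2_quad = phi.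
Proof. by apply: Quad_ext => g; apply: Pol2_lift_gen. Qed.

End Pol2.

Theorem theorem1p2 (G : groupType) :
  exists (Pol2 : groupType)
         (eta : forall H : groupType, group_hom Pol2 H -> Quad G H)
         (phi : Quad G Pol2),
    [/\ forall H : groupType, bijective (eta H),
        forall (H K : groupType) (f : group_hom H K)
               (psi : group_hom Pol2 H),
          eta K (f \o psi) = Quad_map f (eta H psi),
        forall (H : groupType) (psi : group_hom Pol2 H),
          eta H psi = Quad_map psi phi
      & forall (H : groupType) (phi' : Quad G H),
          exists! psi : group_hom Pol2 H,
            phi' = psi \o phi :> (G -> H)].
Proof.
exists (Pol2 G), (fun H psi => Quad_map psi (Pol2_quad G)), (Pol2_quad G).
split=> [H|H K f psi|//|H phi'].
- exists (@Pol2_lift G H); first exact: Pol2_lift_unique.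
  exact: Quad_map_Pol2_lift.
(* Naturality is associativity of composition, which holds pointwise by conversion. *)
- exact: Quad_ext.
- exists (Pol2_lift phi'); split=> [|psi phi'E].
    by apply: funext => g; rewrite -[LHS]Pol2_lift_gen.
  (* Any competitor [psi] is the lift of its own composite with the universal map, and that
     composite is [phi']. *)
  rewrite -[RHS]Pol2_lift_unique; congr Pol2_lift.
  by apply: Quad_ext => g; rewrite phi'E.
Qed.
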